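(* Let $P$ be a probability measure over $\mathbb{R}^d$. Fix $\alpha\in[0,1)$ and $u\in\mathcal{S}^{d-1}$. Then: (i) $P$ admits a spatial quantile $\mu_{\alpha,u}$ of order $\alpha$ in direction $u$. (ii) If $P$ is not concentrated on a line, then the spatial quantile $\mu_{\alpha,u}$ is unique. (iii) If $P$ is not concentrated on a line with direction $u$ and $\alpha>0$, then the spatial quantile $\mu_{\alpha,u}$ is unique. (iv) If $P$ is concentrated on a line with direction $u$, say, the line $\mathcal{L}=\{z_0+\lambda u:\lambda\in\mathbb{R}\}$ (with $z_0\in\mathbb{R}^d$), then any spatial quantile $\mu_{\alpha,u}$ of order $\alpha$ in direction $u$ for $P$ belongs to $\mathcal{L}$; in this case, any such quantile is of the form $\mu_{\alpha,u}=z_0+\ell_\alpha u$, where $\ell_\alpha\in\mathbb{R}$ is a spatial quantile of order $\alpha$ in direction $1$ for $P_{z_0,u}$, with $P_{z_0,u}$ the distribution (on $\mathbb{R}$) of $u'(Z-z_0)$ when $Z$ has distribution $P$.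
   Context: $\|\cdot\|$ is the Euclidean norm on $\mathbb{R}^d$, $x'y$ is the Euclidean inner product, and $\mathcal{S}^{d-1}=\{z\in\mathbb{R}^d:\|z\|=1\}$ is the unit sphere. For a probability measure $P$ over $\mathbb{R}^d$, $\alpha\in[0,1)$ and $u\in\mathcal{S}^{d-1}$, a point $\mu_{\alpha,u}\in\mathbb{R}^d$ is a spatial quantile of order $\alpha$ in direction $u$ for $P$ if and only if it minimizes over $\mathbb{R}^d$ the objective function $\mu\mapsto O^P_{\alpha,u}(\mu):=\int_{\mathbb{R}^d}\{\|z-\mu\|-\|z\|-\alpha u'\mu\}\,dP(z)$. For $d=1$ the same definition applies with $\mathcal{S}^0=\{-1,1\}$, so a spatial quantile of order $\alpha$ in direction $1$ for a probability measure $Q$ on $\mathbb{R}$ is a minimizer over $\lambda\in\mathbb{R}$ of $\int_{\mathbb{R}}\{|t-\lambda|-|t|-\alpha\lambda\}\,dQ(t)$. $P$ is concentrated on a line with direction $u_*\in\mathcal{S}^{d-1}$ if and only if there exists $z_0\in\mathbb{R}^d$ such that $P[\{z_0+\lambda u_*:\lambda\in\mathbb{R}\}]=1$; $P$ is concentrated on a line if and only if there exists $u_*\in\mathcal{S}^{d-1}$ such that $P$ is concentrated on a line with direction $u_*$. *)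

(* Defs.v *)
From HB Require Import structures.
From mathcomp Require Import all_boot all_order all_algebra.
From mathcomp Require Import all_classical all_reals all_analysis.

Set Implicit Arguments.
Unset Strict Implicit.
Unset Printing Implicit Defensive.

Import Order.TTheory GRing.Theory Num.Theory.
Import numFieldNormedType.Exports.

Local Open Scope classical_set_scope.
Local Open Scope ring_scope.

(* R^d with its Borel sigma-algebra. The alias is convertible to 'rV[R]_d; the
   topology on 'rV[R]_d is the product topology, i.e. the Euclidean one. *)
Notation borelRd R d := (g_sigma_algebraType (@open 'rV[R]_d)).

Definition dotv (R : realType) (d : nat) (x y : 'rV[R]_d) : R :=
  \sum_(i < d) x 0 i * y 0 i.

(* The library's `|x| on 'rV[R]_d is the sup norm, hence this definition. *)
Definition enorm (R : realType) (d : nat) (x : 'rV[R]_d) : R :=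
  Num.sqrt (dotv x x).

Definition sphere (R : realType) (d : nat) : set 'rV[R]_d :=
  [set z | enorm z = 1].

(* The integrand is bounded in absolute value by (1 + |alpha| * enorm u) *
   enorm mu, so the integral is finite for every mu, with no moment assumption
   on P; in particular comparing its values in \bar R is comparing reals. *)
Definition objective (R : realType) (d : nat) (P : probability (borelRd R d) R)
    (alpha : R) (u mu : 'rV[R]_d) : \bar R :=
  (\int[P]_(z in [set: borelRd R d])
     (enorm ((z : 'rV[R]_d) - mu) - enorm (z : 'rV[R]_d)
      - alpha * dotv u mu)%:E)%E.

Definition spatial_quantile (R : realType) (d : nat)
    (P : probability (borelRd R d) R) (alpha : R) (u mu : 'rV[R]_d) : Prop :=
  forall nu : 'rV[R]_d, (objective P alpha u mu <= objective P alpha u nu)%E.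

(* The one-dimensional case, stated directly on R rather than on 'rV[R]_1;
   the direction s is meant to be 1 or -1. *)
Definition objective1 (R : realType) (Q : probability R R) (alpha s l : R) :
    \bar R :=
  (\int[Q]_(t in [set: R]) (`|t - l| - `|t| - alpha * (s * l))%:E)%E.

Definition spatial_quantile1 (R : realType) (Q : probability R R)
    (alpha s l : R) : Prop :=
  forall m : R, (objective1 Q alpha s l <= objective1 Q alpha s m)%E.

Definition line (R : realType) (d : nat) (z0 u : 'rV[R]_d) : set 'rV[R]_d :=
  [set z0 + l *: u | l in [set: R]].

Definition concentrated_on_line_dir (R : realType) (d : nat)
    (P : probability (borelRd R d) R) (u : 'rV[R]_d) : Prop :=
  exists z0 : 'rV[R]_d, P (line z0 u) = 1%E.

Definition concentrated_on_line (R : realType) (d : nat)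
    (P : probability (borelRd R d) R) : Prop :=
  exists2 u : 'rV[R]_d, sphere u & concentrated_on_line_dir P u.

Definition line_coord (R : realType) (d : nat) (z0 u : 'rV[R]_d)
    (z : borelRd R d) : R :=
  dotv u ((z : 'rV[R]_d) - z0).

Lemma continuous_line_coord (R : realType) (d : nat) (z0 u : 'rV[R]_d) :
  continuous (fun z : 'rV[R]_d => dotv u (z - z0)).
Proof.
have addC : continuous (fun z : R * R => z.1 + z.2).
  by move=> z; exact: add_continuous.
apply: (@continuous_big R 'I_d +%R 0 xpredT addC 'rV[R]_d) => i _ z.
apply: continuousM; first exact: cst_continuous.
have -> : (fun z : 'rV[R]_d => (z - z0) 0 i) = (fun z => z 0 i - z0 0 i).
  by apply/funext => y; rewrite !mxE.
apply: continuousB; last exact: cst_continuous.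
exact: (@coord_continuous R 1 d 0 i).
Qed.

Lemma measurable_line_coord (R : realType) (d : nat) (z0 u : 'rV[R]_d) :
  measurable_fun [set: borelRd R d] (line_coord z0 u).
Proof.
apply: (measurability _ (measurable_realfun.RGenOpens.measurableE R)).
move=> _ [_ [a [b ->]] <-]; rewrite setTI; apply: sub_sigma_algebra.
have /continuousP := @continuous_line_coord R d z0 u; apply.
exact: interval_open.
Qed.

HB.instance Definition _ (R : realType) (d : nat) (z0 u : 'rV[R]_d) :=
  isMeasurableFun.Build _ _ (borelRd R d) R (line_coord z0 u)
    (measurable_line_coord z0 u).

(* The law on R of u'(Z - z0) when Z has law P. *)
Definition line_distribution (R : realType) (d : nat)
    (P : probability (borelRd R d) R) (z0 u : 'rV[R]_d) : probability R R :=
  distribution P (line_coord z0 u).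

(* Main.v *)
Require Import Defs.
From mathcomp Require Import all_boot all_order all_algebra.
From mathcomp Require Import all_classical all_reals all_analysis.
From mathcomp Require Import measurable_realfun.
From mathcomp Require Import ring lra.
Set Implicit Arguments.
Unset Strict Implicit.
Unset Printing Implicit Defensive.
Import Order.TTheory GRing.Theory Num.Theory.
Import numFieldNormedType.Exports.
Local Open Scope classical_set_scope.
Local Open Scope ring_scope.

(** Subtracting [|z|] in the integrand makes it bounded, so the real-valued
    function [potential P mu], the integral of [|z - mu| - |z|], is defined for
    every [P], and a quantile is a minimizer of
    [potential P mu - alpha (u.mu)].

    Existence.  [potential P] is 1-Lipschitz ([potential_lipschitz]), and it
    grows at least like [c |mu|] for every [c < 1] ([potential_coercive]), since
    a large enough ball carries almost all the mass.  As [alpha |u| < 1], the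
    objective exceeds its value at the origin outside a ball, which is compact.

    Two distinct quantiles [x] and [y].  At their midpoint [m] the objective is
    not larger, by convexity, and not smaller, by minimality, so almost every
    [z] gives equality in [2 |z - m| <= |z - x| + |z - y|] ([ae_midpoint_eq]).
    The equality case of the triangle inequality places [z] on the line through
    [x] and [y], but outside the open segment, hence at distance at least
    [|x - y| / 2] from [m].  This proves uniqueness when [P] is on no line.

    The direction of that line when [alpha > 0].  The midpoint [m] is a quantile
    as well.  If [w] is orthogonal to the line, moving from [m] to [m + t w]
    changes [potential P] by [O(t^2)] only, because [P] has no mass near [m],
    whereas the linear term gains [alpha t (u.w)].  Hence [u.w <= 0] for all
    such [w] ([spatial_quantile_orthogonal]); taking for [w] the component of
    [u] orthogonal to the line shows that [u] directs it
    ([spatial_quantile_dir]).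

    [P] on a line directed by [u].  Projecting [mu] on the line keeps [u.mu] and
    brings [mu] closer to every point of the line, so quantiles are on the line.
    There the objective is, up to a constant, the one-dimensional objective of
    the coordinate along the line ([objective1_line_distribution]). *)

(** * Euclidean geometry *)

Section EuclideanGeometry.
Context {R : realType} {d : nat}.
Implicit Types (x y z a b u v w mu : 'rV[R]_d) (c : R).

Lemma dotvC x y : dotv x y = dotv y x.
Proof. by apply: eq_bigr => i _; rewrite mulrC. Qed.

Lemma dotvDl x y z : dotv (x + y) z = dotv x z + dotv y z.
Proof. by rewrite -big_split; apply: eq_bigr => i _; rewrite !mxE mulrDl. Qed.

Lemma dotvZl c x y : dotv (c *: x) y = c * dotv x y.
Proof. by rewrite mulr_sumr; apply: eq_bigr => i _; rewrite !mxE mulrA. Qed.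

Lemma dotvNl x y : dotv (- x) y = - dotv x y.
Proof. by rewrite -scaleN1r dotvZl mulN1r. Qed.

Lemma dotvDr x y z : dotv x (y + z) = dotv x y + dotv x z.
Proof. by rewrite dotvC dotvDl !(dotvC x). Qed.

Lemma dotvZr c x y : dotv x (c *: y) = c * dotv x y.
Proof. by rewrite dotvC dotvZl dotvC. Qed.

Lemma dotvNr x y : dotv x (- y) = - dotv x y.
Proof. by rewrite dotvC dotvNl dotvC. Qed.

Lemma dotv0r x : dotv x 0 = 0.
Proof. by rewrite -(scale0r 0) dotvZr mul0r. Qed.

Definition dotvE := (dotvDl, dotvDr, dotvZl, dotvZr, dotvNl, dotvNr).

Lemma dotv_pythagoras x y : dotv x y = 0 ->
  dotv (x + y) (x + y) = dotv x x + dotv y y.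
Proof. by move=> xy; rewrite !dotvE (dotvC y x) xy addr0 add0r. Qed.

Lemma dotv_ge0 x : 0 <= dotv x x.
Proof. by apply: sumr_ge0 => i _; rewrite -expr2 sqr_ge0. Qed.

Lemma dotv_eq0 x : (dotv x x == 0) = (x == 0).
Proof.
apply/eqP/eqP => [x0|->]; last exact: dotv0r.
apply/rowP => i; rewrite mxE; apply/eqP; rewrite -sqrf_eq0 expr2.
move/eqP: x0; rewrite psumr_eq0 => [|j _]; last by rewrite -expr2 sqr_ge0.
by move/allP => /(_ i); rewrite mem_index_enum; exact.
Qed.

Lemma enorm_ge0 x : 0 <= enorm x.
Proof. exact: sqrtr_ge0. Qed.

Lemma enorm_sqr x : enorm x ^+ 2 = dotv x x.
Proof. by rewrite sqr_sqrtr ?dotv_ge0. Qed.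

Lemma enorm_eq0 x : (enorm x == 0) = (x == 0).
Proof. by rewrite -sqrf_eq0 enorm_sqr dotv_eq0. Qed.

Lemma enorm0 : enorm (0 : 'rV[R]_d) = 0.
Proof. by apply/eqP; rewrite enorm_eq0. Qed.

Lemma enorm_gt0 x : (0 < enorm x) = (x != 0).
Proof. by rewrite lt_def enorm_ge0 andbT enorm_eq0. Qed.

Lemma enormZ c x : enorm (c *: x) = `|c| * enorm x.
Proof.
by rewrite /enorm !dotvE mulrA -expr2 sqrtrM ?sqr_ge0// sqrtr_sqr.
Qed.

Lemma enormN x : enorm (- x) = enorm x.
Proof. by rewrite -scaleN1r enormZ normrN1 mul1r. Qed.

Lemma enorm_distC x y : enorm (x - y) = enorm (y - x).
Proof. by rewrite -enormN opprB. Qed.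

Lemma le_enorm x c : 0 <= c -> (enorm x <= c) = (dotv x x <= c ^+ 2).
Proof. by move=> c0; rewrite -enorm_sqr ler_sqr ?nnegrE ?enorm_ge0. Qed.

(** Cauchy-Schwarz, from the nonnegativity of the squared norm of
    [|y|^2 x - (x.y) y], which is [|y|^2 (|x|^2 |y|^2 - (x.y)^2)]. *)
Lemma dotv_le_enorm x y : dotv x y <= enorm x * enorm y.
Proof.
have [->|y0] := eqVneq y 0.
  by rewrite enorm0 mulr0 dotv0r.
have yy : 0 < dotv y y by rewrite lt_def dotv_eq0 y0 dotv_ge0.
apply: le_trans (ler_norm _) _.
rewrite -ler_sqr ?nnegrE ?mulr_ge0 ?enorm_ge0//.
rewrite real_normK ?num_real// exprMn !enorm_sqr.
have h : dotv y y * (dotv x x * dotv y y - dotv x y ^+ 2) =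
    dotv (dotv y y *: x - dotv x y *: y) (dotv y y *: x - dotv x y *: y).
  by rewrite !dotvE (dotvC y x); ring.
by rewrite -subr_ge0 -(pmulr_rge0 _ yy) h dotv_ge0.
Qed.

Lemma enormD x y : enorm (x + y) <= enorm x + enorm y.
Proof.
rewrite le_enorm ?addr_ge0 ?enorm_ge0// !dotvE (dotvC y x) sqrrD !enorm_sqr.
have := dotv_le_enorm x y; lra.
Qed.

Lemma enormB_ge x y : enorm x - enorm y <= enorm (x - y).
Proof. by rewrite lerBlDr; have := enormD (x - y) y; rewrite subrK. Qed.

Lemma enormB_abs x y : `|enorm x - enorm y| <= enorm (x - y).
Proof.
rewrite ler_norml enormB_ge andbT lerNl opprB enorm_distC.
exact: enormB_ge.
Qed.

(** Equality in the triangle inequality forces [a.b = |a||b|], so that the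
    squared norm of [|b| a - |a| b] vanishes. *)
Lemma enormD_eq a b : enorm (a + b) = enorm a + enorm b ->
  enorm b *: a = enorm a *: b.
Proof.
move=> /(congr1 (fun r => r ^+ 2)).
rewrite enorm_sqr sqrrD !enorm_sqr !dotvE (dotvC b a) => h.
have {}h : dotv a b = enorm a * enorm b by lra.
apply/eqP; rewrite -subr_eq0 -dotv_eq0 !dotvE (dotvC b a) h -!enorm_sqr.
by apply/eqP; ring.
Qed.

Section Midpoint.
Variables (mu1 mu2 z : 'rV[R]_d).
Local Notation m := (2^-1 *: (mu1 + mu2)).

Lemma twice_sub_midpoint : 2 *: (z - m) = (z - mu1) + (z - mu2).
Proof.
rewrite scalerBr scalerA divff ?pnatr_eq0// scale1r scaler_nat mulr2n.
by rewrite opprD addrACA.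
Qed.

Lemma enorm_midpoint : 2 * enorm (z - m) = enorm ((z - mu1) + (z - mu2)).
Proof. by rewrite -twice_sub_midpoint enormZ ger0_norm. Qed.

Hypothesis eq_mid : 2 * enorm (z - m) = enorm (z - mu1) + enorm (z - mu2).

(** As [z - m] is half the sum of [z - mu1] and [z - mu2], equality makes its
    norm half of [|z - mu1| + |z - mu2|], and the triangle inequality through
    [z] applies.  So [z] is never close to [m], although it is on the line. *)
Lemma midpoint_eq_far : enorm (mu2 - mu1) <= 2 * enorm (z - m).
Proof.
have -> : mu2 - mu1 = (z - mu1) + - (z - mu2).
  by rewrite opprB [RHS]addrC addrA subrK.
by rewrite eq_mid -(enormN (z - mu2)) enormD.
Qed.

(** The vectors [z - mu1] and [z - mu2] are nonnegatively proportional; as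
    their difference is not zero, their norms differ and [z] can be solved
    for. *)
Lemma midpoint_eq_line : mu1 != mu2 -> line mu1 (mu2 - mu1) z.
Proof.
move=> neq; have /enormD_eq : enorm ((z - mu1) + (z - mu2)) =
    enorm (z - mu1) + enorm (z - mu2) by rewrite -enorm_midpoint.
set a := enorm (z - mu1); set b := enorm (z - mu2) => h.
have {}h : (b - a) *: (z - mu1) = - a *: (mu2 - mu1).
  rewrite scalerBl h -scalerBr scaleNr -scalerN; congr (_ *: _).
  by rewrite !opprB [LHS]addrC addrA subrK.
have ba : b - a != 0.
  (* equal norms would force both vectors to vanish, hence [mu1 = mu2] *)
  apply/eqP => ba; move: h; rewrite ba scale0r => /esym/eqP.
  rewrite scaler_eq0 oppr_eq0 subr_eq0 [mu2 == _]eq_sym (negbTE neq) orbF.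
  move=> /eqP a0.
  move: ba; rewrite a0 subr0 => b0; move/eqP: neq; apply.
  move/eqP: a0; rewrite enorm_eq0 subr_eq0 => /eqP <-.
  by move/eqP: b0; rewrite enorm_eq0 subr_eq0 => /eqP.
exists (- a / (b - a)) => //.
by rewrite mulrC -scalerA -h scalerA mulVf// scale1r addrC subrK.
Qed.

End Midpoint.

Lemma line_scale z0 v c : c != 0 -> line z0 v `<=` line z0 (c *: v).
Proof.
move=> c0 _ [l _ <-]; exists (l / c) => //.
by rewrite scalerA divfK.
Qed.

(** Moving orthogonally to [x] changes the distance to the origin only to
    second order: this is [sqrt (X^2 + Y^2) <= X + Y^2 / (2 X)], with [c] in
    place of [X] in the denominator. *)
Lemma enorm_orthogonal_le x y c : 0 < c -> c <= enorm x -> dotv x y = 0 ->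
  enorm (x - y) <= enorm x + dotv y y / (2 * c).
Proof.
move=> c0 cx xy; have yy : 0 <= dotv y y / (2 * c).
  by rewrite divr_ge0 ?dotv_ge0 ?mulr_ge0// ltW.
rewrite le_enorm ?addr_ge0 ?enorm_ge0// dotv_pythagoras; last first.
  by rewrite dotvNr xy oppr0.
rewrite dotvNl dotvNr opprK sqrrD enorm_sqr.
have : c * (dotv y y / (2 * c)) <= enorm x * (dotv y y / (2 * c)).
  exact: ler_wpM2r.
have -> : c * (dotv y y / (2 * c)) = dotv y y / 2.
  by field; rewrite gt_eqF.
have := sqr_ge0 (dotv y y / (2 * c)); lra.
Qed.

End EuclideanGeometry.

(** * Almost sure statements from integrals of bounded functions *)

Section BoundedIntegrands.
Context {disp : measure_display} {T : measurableType disp} {R : realType}.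
Variable P : probability T R.
Implicit Types f g : T -> R.

Lemma bounded_integrable f c : measurable_fun [set: T] f ->
  (forall z, `|f z| <= c) -> P.-integrable [set: T] (EFin \o f).
Proof.
move=> mf fc; apply: measurable_bounded_integrable => //.
  by apply: le_lt_trans (probability_le1 P measurableT) _; rewrite ltry.
exists c; split; first exact: num_real.
by move=> y /ltW cy z _; apply: le_trans (fc z) cy.
Qed.

Lemma integrable_constant c : P.-integrable [set: T] (EFin \o cst c).
Proof. exact: (@bounded_integrable (cst c) `|c|). Qed.

Lemma Rintegral_constant c : \int[P]_(z in [set: T]) (cst c z) = c.
Proof.
rewrite Rintegral_cst// [X in fine X](_ : _ = 1%E) ?mulr1//.
exact: probability_setT.
Qed.

Lemma ae_eq_Rintegral f g : measurable_fun [set: T] f ->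
  measurable_fun [set: T] g -> {ae P, forall z, f z = g z} ->
  \int[P]_(z in [set: T]) f z = \int[P]_(z in [set: T]) g z.
Proof.
move=> mf mg fg; congr fine; apply: ae_eq_integral => //.
- exact/measurable_EFinP.
- exact/measurable_EFinP.
- by apply: filterS fg => z -> _.
Qed.

Lemma ae_Rintegral_ge0 f : measurable_fun [set: T] f ->
  {ae P, forall z, 0 <= f z} -> 0 <= \int[P]_(z in [set: T]) f z.
Proof.
move=> mf f0; rewrite (_ : Rintegral _ _ _ = \int[P]_(z in [set: T]) `|f z|).
  by apply: Rintegral_ge0.
apply: ae_eq_Rintegral => //; first exact: measurableT_comp.
by apply: filterS f0 => z fz; rewrite ger0_norm.
Qed.

(** In the uses below, geometry makes the integrand nonnegative and minimality
    makes the integral nonpositive. *)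
Lemma ae_Rintegral_le0_eq0 f : P.-integrable [set: T] (EFin \o f) ->
  {ae P, forall z, 0 <= f z} -> \int[P]_(z in [set: T]) f z <= 0 ->
  {ae P, forall z, f z = 0}.
Proof.
move=> intf f0 If0; have mf := measurable_int _ intf.
have : (\int[P]_(z in [set: T]) `|(EFin \o f) z| = 0)%E.
  rewrite -(fineK (integrable_fin_num measurableT (integrable_norm intf))).
  congr EFin; apply/eqP.
  have mrf : measurable_fun [set: T] f by exact/measurable_EFinP.
  rewrite (_ : fine _ = \int[P]_(z in [set: T]) f z).
    by rewrite eq_le If0 /= ae_Rintegral_ge0.
  apply: ae_eq_Rintegral => //; first exact: measurableT_comp.
  by apply: filterS f0 => z fz; rewrite /= ger0_norm.
move/(ae_eq_integral_abs P measurableT mf); apply: filterS => z /(_ I).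
by case.
Qed.

(** Monotonicity of almost sure statements, with the filter condition settled
    once for an abstract measurable type. *)
Lemma ae_imp (A B : T -> Prop) : {ae P, forall z, A z} ->
  (forall z, A z -> B z) -> {ae P, forall z, B z}.
Proof. by move=> aeA AB; apply: filterS aeA. Qed.

Lemma ae_witness (A B : T -> Prop) :
  {ae P, forall z, A z} -> {ae P, forall z, B z} -> exists z, A z /\ B z.
Proof.
move=> aeA aeB.
have P0 : (0 < (P : set T -> \bar R) [set: T])%E.
  by rewrite [X in (_ < X)%E](probability_setT P) lte01.
have pf := ae_properfilter_algebraOfSetsType P0.
by have [z ABz] := filter_ex (filterI aeA aeB); exists z.
Qed.

End BoundedIntegrands.

(** * Measurability of distances and lines *)

Section Measurability.
Context {R : realType} {d : nat}.
Implicit Types (u z mu x y : 'rV[R]_d).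

Lemma continuous_measurable_borelRd (f : 'rV[R]_d -> R) :
  continuous f -> measurable_fun [set: borelRd R d] (f : borelRd R d -> R).
Proof.
move=> cf.
apply: (measurability _ (RGenOpens.measurableE R)).
move=> _ [_ [a [b ->]] <-]; rewrite setTI; apply: sub_sigma_algebra.
by move/continuousP : cf; apply; exact: interval_open.
Qed.

Lemma continuous_enorm_sub mu : continuous (fun z : 'rV[R]_d => enorm (z - mu)).
Proof.
move=> z; apply: (@continuous_comp _ _ _
  (fun z : 'rV[R]_d => dotv (z - mu) (z - mu)) (@Num.sqrt R)); last first.
  exact: sqrt_continuous.
move: z.
have addC : continuous (fun z : R * R => z.1 + z.2).
  by move=> z; exact: add_continuous.
apply: (@continuous_big R 'I_d +%R 0 xpredT addC 'rV[R]_d) => i _ z.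
have coord : {for z, continuous (fun y : 'rV[R]_d => (y - mu) 0 i)}.
  rewrite (_ : (fun y => _) = (fun y : 'rV[R]_d => y 0 i - mu 0 i)).
    apply: continuousB; last exact: cst_continuous.
    exact: (@coord_continuous R 1 d 0 i).
  by apply/funext => y; rewrite !mxE.
exact: (continuousM coord coord).
Qed.

Lemma measurable_enorm_sub mu : measurable_fun [set: borelRd R d]
  (fun z : borelRd R d => enorm ((z : 'rV[R]_d) - mu)).
Proof.
by apply: continuous_measurable_borelRd; exact: continuous_enorm_sub.
Qed.

Lemma measurable_enorm : measurable_fun [set: borelRd R d]
  (fun z : borelRd R d => enorm (z : 'rV[R]_d)).
Proof.
have := measurable_enorm_sub 0; congr measurable_fun.
by apply/funext => z; rewrite subr0.
Qed.

(** This exhibits the squared distance to the line as a measurable function of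
    [x]; the line, being its zero set, is measurable. *)
Lemma sub_projection_sqr u z0 x y : enorm u = 1 ->
  y = z0 + dotv u (x - z0) *: u ->
  dotv (x - y) (x - y) = dotv (x - z0) (x - z0) - dotv u (x - z0) ^+ 2.
Proof.
move=> u1 ->; have uu : dotv u u = 1 by rewrite -enorm_sqr u1 expr1n.
rewrite opprD addrA; move: (x - z0) => t.
by rewrite !dotvE uu (dotvC t u); ring.
Qed.

Lemma line_eq_projection u z0 x : enorm u = 1 -> line z0 u x ->
  x = z0 + dotv u (x - z0) *: u.
Proof.
move=> u1 [l _ <-].
by rewrite addrAC subrr add0r dotvZr -enorm_sqr u1 expr1n mulr1.
Qed.

Lemma measurable_line u z0 : enorm u = 1 ->
  measurable (line z0 u : set (borelRd R d)).
Proof.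
move=> u1.
pose h (z : borelRd R d) : R :=
  enorm ((z : 'rV[R]_d) - z0) ^+ 2 - line_coord z0 u z ^+ 2.
have mh : measurable_fun [set: borelRd R d] h.
  apply: measurable_funB; apply: measurable_funX.
    exact: measurable_enorm_sub.
  exact: measurable_line_coord.
rewrite (_ : line z0 u = [set: borelRd R d] `&` h @^-1` [set 0]).
  exact: mh.
apply/seteqP; rewrite setTI /h /=; split => z /=.
  move=> Lz; rewrite enorm_sqr -(sub_projection_sqr u1 erefl).
  by rewrite -(line_eq_projection u1 Lz) subrr -enorm_sqr enorm0 expr0n.
rewrite enorm_sqr -(sub_projection_sqr u1 erefl) => /eqP.
by rewrite dotv_eq0 subr_eq0 => /eqP ->; exists (dotv u (z - z0)).
Qed.

Lemma ae_line (P : probability (borelRd R d) R) u z0 : enorm u = 1 ->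
  P (line z0 u) = 1%E <-> {ae P, forall z : borelRd R d, line z0 u z}.
Proof.
move=> u1; have mL := measurable_line z0 u1.
have mLC : measurable (~` (line z0 u : set (borelRd R d))).
  exact: measurableC.
split=> [PL|/(negligibleP P mLC) PLC].
  apply/(negligibleP P mLC).
  by rewrite [LHS](probability_setC P mL) [X in (_ - X)%E]PL subee.
have := probability_setC P mLC.
by rewrite setCK => ->; rewrite [X in (1 - X)%E]PLC sube0.
Qed.

End Measurability.

(** * The potential and the existence of quantiles *)

Section Potential.
Context {R : realType} {d : nat}.
Variable P : probability (borelRd R d) R.
Implicit Types (alpha c : R) (u v mu nu : 'rV[R]_d).

Local Notation dist z mu := (enorm ((z : 'rV[R]_d) - mu)).

(** The objective without its linear term, as a real number. *)
Definition potential mu : R :=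
  \int[P]_(z in [set: borelRd R d]) (dist z mu - enorm (z : 'rV[R]_d)).

Lemma integrable_distB mu nu :
  P.-integrable [set: borelRd R d] (EFin \o (fun z => dist z mu - dist z nu)).
Proof.
apply: (@bounded_integrable _ _ _ _ _ (enorm (nu - mu))) => [|z].
  by apply: measurable_funB; exact: measurable_enorm_sub.
apply: le_trans (enormB_abs _ _) _.
by rewrite opprB addrC addrA subrK.
Qed.

Lemma integrable_potential mu : P.-integrable [set: borelRd R d]
  (EFin \o (fun z : borelRd R d => dist z mu - enorm (z : 'rV[R]_d))).
Proof.
have := integrable_distB mu 0; congr integrable.
by apply/funext => z; rewrite /= subr0.
Qed.

(** The normalization [- |z|] cancels in differences. *)
Lemma potentialB mu nu : potential mu - potential nu =
  \int[P]_(z in [set: borelRd R d]) (dist z mu - dist z nu).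
Proof.
rewrite /potential -RintegralB//; last 2 first.
- exact: integrable_potential.
- exact: integrable_potential.
by congr Rintegral; apply/funext => z; rewrite opprB addrA subrK.
Qed.

Lemma objectiveE alpha u mu :
  objective P alpha u mu = (potential mu - alpha * dotv u mu)%:E.
Proof.
have icst : P.-integrable [set: borelRd R d] (EFin \o cst (alpha * dotv u mu)).
  exact: integrable_constant.
have iO : P.-integrable [set: borelRd R d] (EFin \o (fun z : borelRd R d =>
    dist z mu - enorm (z : 'rV[R]_d) - alpha * dotv u mu)).
  have := integrableB measurableT (integrable_potential mu) icst.
  by congr integrable; apply/funext => z.
rewrite /objective -[LHS]fineK ?(integrable_fin_num measurableT iO)//.
congr EFin; transitivity (potential mu -
    \int[P]_(z in [set: borelRd R d]) cst (alpha * dotv u mu) z).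
  by rewrite -RintegralB//; exact: integrable_potential.
by rewrite Rintegral_constant.
Qed.

Lemma spatial_quantileP alpha u mu : spatial_quantile P alpha u mu <->
  forall nu, alpha * dotv u (nu - mu) <= potential nu - potential mu.
Proof.
by split=> q nu; have := q nu; rewrite !objectiveE lee_fin dotvDr dotvNr; lra.
Qed.

Lemma potential_lipschitz mu nu :
  potential mu - potential nu <= enorm (mu - nu).
Proof.
rewrite potentialB -[leRHS](Rintegral_constant P); apply: le_Rintegral => //.
- exact: integrable_distB.
- exact: integrable_constant.
move=> z _; apply: le_trans (enormB_ge _ _) _.
by rewrite opprB addrC addrA subrK enorm_distC.
Qed.

Lemma potential_continuous : continuous potential.
Proof.
move=> nu; have Fnu : Filter (nbhs nu) by exact: nbhs_filter.
apply/(@cvgrPdist_le _ _ _ _ Fnu) => e e0.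
have near_e : \forall mu \near nu, `|0 - enorm (mu - nu)| <= e.
  have := @continuous_enorm_sub R d nu nu; rewrite /continuous_at subrr enorm0.
  by move/(@cvgrPdist_le _ _ _ _ Fnu); exact.
apply: filterS near_e => mu.
rewrite sub0r normrN ger0_norm ?enorm_ge0// => le_e.
rewrite ler_norml; apply/andP; split.
  by rewrite lerNl opprB (le_trans (potential_lipschitz _ _)).
by apply: le_trans (potential_lipschitz _ _) _; rewrite enorm_distC.
Qed.

(** Tightness: the distribution function of [|z|] tends to [1] at infinity. *)
Lemma ball_mass_ge c : c < 1 ->
  exists2 M : R, 0 <= M & c <= fine (P [set z | enorm (z : 'rV[R]_d) <= M]).
Proof.
move=> c1.
pose X := mfun_Sub (mem_set (@measurable_enorm R d)) : {RV P >-> R}.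
have X1 : fine \o cdf X @ +oo --> (1 : R) by apply/fine_cvg/cvg_cdfy1.
have [M [M0 cM]] : exists M : R, 0 <= M /\ c < fine (cdf X M).
  apply: (@filter_ex _ (pinfty_nbhs R)); apply: filterI.
    exact: nbhs_pinfty_ge.
  exact: cvgr_gt X1 _ c1.
exists M => //; exact/ltW.
Qed.

(** On the ball of radius [M] the integrand is at least [|mu| - 2 M], and it is
    everywhere at least [- |mu|]; when the ball has mass [p], the integral is at
    least [(2 p - 1) |mu| - 2 p M], and [p] can be taken close to [1]. *)
Lemma potential_coercive c : c < 1 ->
  exists M : R, forall mu, c * enorm mu - M <= potential mu.
Proof.
move=> c1; have [|M M0 cM] := @ball_mass_ge ((1 + c) / 2); first lra.
exists (2 * M) => mu.
pose A := [set z : borelRd R d | enorm (z : 'rV[R]_d) <= M].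
have mA : measurable A.
  rewrite (_ : A = [set: borelRd R d] `&`
      (fun z : borelRd R d => enorm (z : 'rV[R]_d)) @^-1` `]-oo, M]).
    by apply: measurable_enorm => //; exact: measurable_itv.
  by apply/seteqP; rewrite setTI; split=> z /=; rewrite in_itv.
set p := fine (P A) in cM.
have p1 : p <= 1 by rewrite -lee_fin fineK ?fin_num_measure// probability_le1.
have mI : measurable_fun [set: borelRd R d] (\1_A : _ -> R).
  exact: measurable_indic.
have I1 z : `|\1_A z : R| <= 1.
  by rewrite indicE; case: (_ \in _); rewrite ?normr1 ?normr0.
have i1 : P.-integrable [set: borelRd R d]
    (EFin \o (fun z => 2 * (enorm mu - M) * \1_A z)).
  apply: (@bounded_integrable _ _ _ _ _ `|2 * (enorm mu - M)|) => [|z].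
    exact: measurable_funM.
  by rewrite normrM ler_piMr.
have i2 := integrable_constant P (enorm mu).
have i12 : P.-integrable [set: borelRd R d]
    (EFin \o (fun z => 2 * (enorm mu - M) * \1_A z - enorm mu)).
  have := integrableB measurableT i1 i2.
  by congr integrable; apply/funext.
have IA : \int[P]_(z in [set: borelRd R d]) \1_A z = p.
  congr fine; rewrite -[in RHS](setIT A).
  exact: (integral_indic P measurableT mA).
(* the integrand below is [|mu| - 2 M] on the ball and [- |mu|] outside *)
apply: (@le_trans _ _ (\int[P]_(z in [set: borelRd R d])
    (2 * (enorm mu - M) * \1_A z - cst (enorm mu) z))).
  rewrite RintegralB// Rintegral_constant RintegralZl//; last first.
    exact: (@bounded_integrable _ _ _ _ _ 1).
  rewrite IA; have := enorm_ge0 mu; nra.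
apply: le_Rintegral => //; first exact: integrable_potential.
move=> z _ /=; rewrite indicE; case: (boolP (z \in A)) => [zA|_] /=.
  have {zA}zM : enorm (z : 'rV[R]_d) <= M by exact: set_mem zA.
  have := enormB_ge mu z; rewrite enorm_distC mulr1; lra.
have := enormB_ge z mu; rewrite mulr0; lra.
Qed.

Lemma potential0 : potential 0 = 0.
Proof.
rewrite /potential (_ : (fun z => _) = cst 0) ?Rintegral_cst ?mul0r//.
by apply/funext => z; rewrite subr0 subrr.
Qed.

(** Coercivity with a slope strictly between [alpha] and [1] confines the
    minimization to a ball. *)
Lemma spatial_quantile_exists alpha u : 0 <= alpha < 1 -> enorm u = 1 ->
  exists mu, spatial_quantile P alpha u mu.
Proof.
move=> /andP[a0 a1] u1; pose f mu := potential mu - alpha * dotv u mu.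
have [|M leM] := @potential_coercive ((1 + alpha) / 2); first lra.
(* beyond [K] the bound [(1 + alpha) / 2 |mu| - M - alpha |mu|] is positive *)
pose K := Num.max 0 (2 * M / (1 - alpha)).
have K0 : 0 <= K by rewrite /K le_max lexx.
pose A := [set mu : 'rV[R]_d | enorm mu <= K].
have f_out mu : ~ A mu -> f 0 <= f mu.
  rewrite /A /= => /negP; rewrite -ltNge gt_max => /andP[_].
  rewrite ltr_pdivrMr ?subr_gt0// => Kmu.
  have := leM mu; have := dotv_le_enorm u mu.
  rewrite u1 mul1r => /(ler_wpM2l a0).
  rewrite /f potential0 dotv0r; lra.
have cf : continuous f.
  move=> mu; apply: continuousB; first exact: potential_continuous.
  apply: continuousM; first exact: cst_continuous.
  have := @continuous_line_coord R d 0 u mu; congr continuous_at.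
  by apply/funext => z; rewrite subr0.
have cA : compact A.
  apply: bounded_closed_compact.
    exists K; split; first exact: num_real.
    move=> k Kk mu /= muK; rewrite [leLHS]/Num.norm /= mx_normrE.
    apply/bigmax_leP; split=> [|i _]; first exact/ltW/(le_lt_trans K0).
    rewrite (ord1 i.1) (le_trans _ (le_trans muK (ltW Kk)))//.
    rewrite -ler_sqr ?nnegrE ?enorm_ge0// real_normK ?num_real// enorm_sqr.
    rewrite /dotv (bigD1 i.2)//= -expr2 lerDl sumr_ge0// => j _.
    by rewrite -expr2 sqr_ge0.
  rewrite (_ : A =
      (fun mu : 'rV[R]_d => enorm (mu - 0)) @^-1` [set x | x <= K]).
    by apply: closed_comp (@closed_le _ K) => mu _; exact: continuous_enorm_sub.
  by apply/seteqP; split=> mu /=; rewrite subr0.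
have A0 : A 0 by rewrite /A /= enorm0.
have [|mu _ min_mu] := EVT_min_rV _ cA (continuous_subspaceT cf).
  by exists 0.
exists mu => nu; rewrite !objectiveE lee_fin -!/(f _).
have [Anu|Anu] := pselect (A nu); first exact/min_mu/mem_set.
by apply: le_trans (f_out _ Anu); exact/min_mu/mem_set.
Qed.

End Potential.

(** * Pairs of distinct quantiles *)

Section Uniqueness.
Context {R : realType} {d : nat}.
Variable P : probability (borelRd R d) R.
Implicit Types (alpha c : R) (u v w mu nu x y z : 'rV[R]_d).

(** The defect of convexity of [mu |-> |z - mu|] at the midpoint, written with
    differences of distances so that it is integrable without any moment. *)
Definition midpoint_defect x y (z : borelRd R d) : R :=
  (enorm ((z : 'rV[R]_d) - x) - enorm ((z : 'rV[R]_d) - 2^-1 *: (x + y))) +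
  (enorm ((z : 'rV[R]_d) - y) - enorm ((z : 'rV[R]_d) - 2^-1 *: (x + y))).

Lemma midpoint_defect_ge0 x y (z : borelRd R d) : 0 <= midpoint_defect x y z.
Proof.
rewrite /midpoint_defect.
have := enormD ((z : 'rV[R]_d) - x) ((z : 'rV[R]_d) - y).
rewrite -enorm_midpoint; lra.
Qed.

Lemma Rintegral_midpoint_defect x y :
  \int[P]_(z in [set: borelRd R d]) midpoint_defect x y z =
  potential P x + potential P y - 2 * potential P (2^-1 *: (x + y)).
Proof.
rewrite /midpoint_defect RintegralD -?potentialB//; try exact: integrable_distB.
ring.
Qed.

Lemma potential_midpoint_le x y :
  2 * potential P (2^-1 *: (x + y)) <= potential P x + potential P y.
Proof.
rewrite -subr_ge0 -Rintegral_midpoint_defect.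
by apply: Rintegral_ge0 => z _; exact: midpoint_defect_ge0.
Qed.

(** The linear term is affine, so the integral of the defect of convexity is
    that of the objective, which is nonpositive when [x] and [y] are minimizers;
    the defect, being nonnegative, vanishes almost surely. *)
Lemma ae_midpoint_eq alpha u x y :
  spatial_quantile P alpha u x -> spatial_quantile P alpha u y ->
  {ae P, forall z : borelRd R d,
    2 * enorm ((z : 'rV[R]_d) - 2^-1 *: (x + y)) =
    enorm ((z : 'rV[R]_d) - x) + enorm ((z : 'rV[R]_d) - y)}.
Proof.
move=> /spatial_quantileP qx /spatial_quantileP qy.
have ih : P.-integrable [set: borelRd R d] (EFin \o midpoint_defect x y).
  have := integrableD measurableT (integrable_distB P x (2^-1 *: (x + y)))
    (integrable_distB P y (2^-1 *: (x + y))).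
  by congr integrable; apply/funext.
have defect0 : {ae P, forall z, midpoint_defect x y z = 0}.
  apply: ae_Rintegral_le0_eq0 => //.
    by apply: aeW => z; exact: midpoint_defect_ge0.
  rewrite Rintegral_midpoint_defect; set m := 2^-1 *: (x + y).
  have := qx m; have := qy m.
  have : alpha * dotv u (m - x) + alpha * dotv u (m - y) = 0.
    by rewrite /m !dotvE; field.
  lra.
by refine (ae_imp defect0 _) => z; rewrite /midpoint_defect; lra.
Qed.

Lemma spatial_quantile_midpoint alpha u x y :
  spatial_quantile P alpha u x -> spatial_quantile P alpha u y ->
  spatial_quantile P alpha u (2^-1 *: (x + y)).
Proof.
move=> /spatial_quantileP qx /spatial_quantileP qy.
apply/spatial_quantileP => nu; have := potential_midpoint_le x y.
set m := 2^-1 *: (x + y).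
have : 2 * (alpha * dotv u (nu - m)) =
    alpha * dotv u (nu - x) + alpha * dotv u (nu - y).
  by rewrite /m !dotvE; field.
have := qx nu; have := qy nu; lra.
Qed.

(** First-order optimality at [m] in the direction [w].  Since [P] stays at
    distance [c] from [m] and lies orthogonally to [w], the potential at
    [m + t w] exceeds that at [m] by at most [t^2 |w|^2 / (2 c)], while
    minimality makes the excess at least [alpha t (u.w)]; let [t] tend to 0. *)
Lemma spatial_quantile_orthogonal alpha u m w c :
  spatial_quantile P alpha u m -> 0 < c ->
  {ae P, forall z : borelRd R d, c <= enorm ((z : 'rV[R]_d) - m) /\
     dotv ((z : 'rV[R]_d) - m) w = 0} ->
  alpha * dotv u w <= 0.
Proof.
move=> /spatial_quantileP qm c0 H.
suff le_t t : 0 < t -> alpha * dotv u w <= t * (dotv w w / (2 * c)).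
  rewrite leNgt; apply/negP => a0.
  have w0 : 0 < dotv w w / (2 * c) + 1.
    by rewrite ltr_wpDl// divr_ge0 ?dotv_ge0// mulr_ge0// ltW.
  (* a value of [t] small enough to contradict [le_t] *)
  have := le_t _ (divr_gt0 a0 w0); rewrite leNgt => /negP; apply.
  rewrite mulrAC -mulrA gtr_pMr// ltr_pdivrMr// mul1r ltrDl//.
move=> t0; rewrite -(ler_pM2l t0).
have := qm (m + t *: w); rewrite addrAC subrr add0r dotvZr mulrCA => /le_trans.
apply; rewrite potentialB.
rewrite -[leRHS](Rintegral_constant P) -subr_ge0 -RintegralB//; last 2 first.
- exact: integrable_constant.
- exact: integrable_distB.
apply: ae_Rintegral_ge0.
  apply: measurable_funB => //.
  by apply: measurable_funB; exact: measurable_enorm_sub.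
refine (ae_imp H _) => z [cz zw].
rewrite subr_ge0 lerBlDl opprD addrA.
have zw' : dotv ((z : 'rV[R]_d) - m) (t *: w) = 0 by rewrite dotvZr zw mulr0.
apply: le_trans (enorm_orthogonal_le c0 cz zw') _.
by rewrite lerD2l dotvZl dotvZr !mulrA.
Qed.

Lemma spatial_quantile_line alpha u x y : x != y ->
  spatial_quantile P alpha u x -> spatial_quantile P alpha u y ->
  {ae P, forall z : borelRd R d, line x (y - x) z}.
Proof.
move=> xy qx qy; refine (ae_imp (ae_midpoint_eq qx qy) _) => z eq_mid.
exact: midpoint_eq_line.
Qed.

(** Otherwise the component of [u] orthogonal to [y - x] would be a direction of
    descent at the midpoint, which carries no mass nearby. *)
Lemma spatial_quantile_dir alpha u x y : enorm u = 1 -> 0 < alpha -> x != y ->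
  spatial_quantile P alpha u x -> spatial_quantile P alpha u y ->
  exists2 c, c != 0 & u = c *: (y - x).
Proof.
move=> u1 a0 xy qx qy; have [v vE] : exists v, v = y - x by eexists.
pose m := 2^-1 *: (x + y).
have vv0 : 0 < dotv v v.
  by rewrite lt_def dotv_ge0 dotv_eq0 vE subr_eq0 eq_sym xy.
(* [|v|^2] times the component of [u] orthogonal to [v] *)
have [w wE] : exists w, w = dotv v v *: u - dotv u v *: v by eexists.
have wv : dotv w v = 0 by rewrite wE !dotvE; ring.
have : alpha * dotv u w <= 0.
  apply: (@spatial_quantile_orthogonal _ _ m _ (enorm v / 2)).
  - exact: spatial_quantile_midpoint.
  - by rewrite divr_gt0// enorm_gt0 vE subr_eq0 eq_sym.
  refine (ae_imp (ae_midpoint_eq qx qy) _) => z eq_mid; split.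
    by rewrite ler_pdivrMr// mulrC vE; exact: midpoint_eq_far.
  have [l _ <-] := midpoint_eq_line eq_mid xy.
  have -> : x + l *: (y - x) - m = (l - 2^-1) *: v.
    by apply/rowP => i; rewrite /m vE !mxE; field.
  by rewrite dotvZl dotvC wv mulr0.
rewrite pmulr_rle0// => uw.
have : dotv w w <= 0.
  have -> : dotv w w = dotv v v * dotv u w - dotv u v * dotv w v.
    by rewrite {1}wE !dotvE (dotvC v w).
  rewrite wv mulr0 subr0.
  by rewrite pmulr_rle0.
rewrite le_eqVlt ltNge dotv_ge0 orbF dotv_eq0 wE subr_eq0 => /eqP uv.
have uE : u = (dotv u v / dotv v v) *: v.
  by rewrite mulrC -scalerA -uv scalerA mulVf ?scale1r// gt_eqF.
exists (dotv u v / dotv v v); last by rewrite -vE.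
apply/eqP => c0; move: u1; rewrite uE c0 scale0r enorm0 => /eqP.
by rewrite eq_sym oner_eq0.
Qed.

End Uniqueness.

(** * Measures on a line directed by [u] *)

Section OnALine.
Context {R : realType} {d : nat}.
Variable P : probability (borelRd R d) R.
Variables (alpha : R) (u z0 : 'rV[R]_d).
Hypothesis u1 : enorm u = 1.
Hypothesis PL : P (line z0 u) = 1%E.
Implicit Types mu : 'rV[R]_d.

(** The projection [p] of [mu] on the line has the same linear term and, by
    Pythagoras, is at least as close to every point of the line.  Minimality of
    [mu] forces equal distances almost surely, and a single point of the line
    with equal distances gives [mu = p]. *)
Lemma spatial_quantile_in_line mu :
  spatial_quantile P alpha u mu -> line z0 u mu.
Proof.
move=> /spatial_quantileP q; pose p := z0 + dotv u (mu - z0) *: u.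
have up : dotv u (p - mu) = 0.
  by rewrite !dotvE -enorm_sqr u1 expr1n; ring.
have pyth (z : borelRd R d) : line z0 u z ->
    enorm ((z : 'rV[R]_d) - mu) ^+ 2 =
    enorm ((z : 'rV[R]_d) - p) ^+ 2 + enorm (p - mu) ^+ 2.
  move=> [l _ <-]; rewrite !enorm_sqr.
  rewrite -dotv_pythagoras; first by rewrite addrA subrK.
  have -> : z0 + l *: u - p = (l - dotv u (mu - z0)) *: u.
    by rewrite opprD addrACA subrr add0r scalerBl.
  by rewrite dotvZl up mulr0.
have aeL := (ae_line P z0 u1).1 PL.
have ae0 : {ae P, forall z : borelRd R d,
    enorm ((z : 'rV[R]_d) - mu) - enorm ((z : 'rV[R]_d) - p) = 0}.
  apply: ae_Rintegral_le0_eq0; first exact: integrable_distB.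
    refine (ae_imp aeL _) => z Lz; rewrite subr_ge0.
    by rewrite le_enorm ?enorm_ge0// -enorm_sqr pyth// lerDl sqr_ge0.
  by have := q p; rewrite up mulr0 -potentialB subr_ge0 subr_le0.
have [z [Lz /eqP]] := ae_witness aeL ae0.
rewrite subr_eq0 => /eqP zE.
have /eqP : enorm (p - mu) ^+ 2 = 0 by have := pyth z Lz; rewrite zE; lra.
rewrite sqrf_eq0 enorm_eq0 subr_eq0 => /eqP <-.
by exists (dotv u (mu - z0)).
Qed.

(** On the line, distances are distances between coordinates.  The constant
    [potential P z0] appears because the coordinate is normalized by its
    distance to [z0], and not by the norm. *)
Lemma objective1_line_distribution l :
  objective1 (line_distribution P z0 u) alpha 1 l =
  (potential P (z0 + l *: u) - potential P z0 - alpha * l)%:E.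
Proof.
have aeL := (ae_line P z0 u1).1 PL.
pose g (t : R) := `|t - l| - `|t| - alpha * (1 * l).
have mg : measurable_fun [set: R] g.
  apply: measurable_funB => //; apply: measurable_funB => //.
  apply: measurableT_comp => //; exact: measurable_funB.
have gb t : `|g t| <= `|l| + `|alpha * (1 * l)|.
  apply: le_trans (ler_normB _ _) _; rewrite lerD2r.
  apply: le_trans (ler_dist_dist _ _) _.
  by rewrite addrAC subrr add0r normrN.
have ig : P.-integrable [set: borelRd R d] (EFin \o (g \o line_coord z0 u)).
  apply: (@bounded_integrable _ _ _ _ _ (`|l| + `|alpha * (1 * l)|)).
    by apply: measurableT_comp => //; exact: measurable_line_coord.
  by move=> z; exact: gb.
rewrite /objective1 /line_distribution integral_distribution//; last first.
  exact/measurable_EFinP.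
rewrite -[LHS]fineK ?(integrable_fin_num measurableT ig)//; congr EFin.
rewrite potentialB -[X in _ - X](Rintegral_constant P).
rewrite -RintegralB//; last 2 first.
- exact: integrable_distB.
- exact: integrable_constant.
apply: (@ae_eq_Rintegral _ _ _ P (g \o line_coord z0 u)).
- apply/measurable_EFinP; exact: measurable_int ig.
- apply: measurable_funB => //.
  by apply: measurable_funB; exact: measurable_enorm_sub.
refine (ae_imp aeL _) => z [s _ <-]; rewrite /g /= mul1r; congr (_ - _ - _).
  rewrite /line_coord addrAC subrr add0r dotvZr -enorm_sqr u1 expr1n mulr1.
  by rewrite opprD addrACA subrr add0r -scalerBl enormZ u1 mulr1.
rewrite /line_coord addrAC subrr add0r dotvZr -enorm_sqr u1 expr1n mulr1.
by rewrite enormZ u1 mulr1.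
Qed.

Lemma spatial_quantile1_of_line l : spatial_quantile P alpha u (z0 + l *: u) ->
  spatial_quantile1 (line_distribution P z0 u) alpha 1 l.
Proof.
move=> /spatial_quantileP q k; rewrite !objective1_line_distribution lee_fin.
have := q (z0 + k *: u).
rewrite opprD addrACA subrr add0r -scalerBl dotvZr -enorm_sqr u1 expr1n mulr1.
lra.
Qed.

End OnALine.

(** * Existence, uniqueness and location of spatial quantiles *)

Theorem theorem1 (R : realType) (d : nat) (P : probability (borelRd R d) R)
    (alpha : R) (u : 'rV[R]_d) (halpha : 0 <= alpha < 1)
    (hu : sphere u) :
  [/\ exists mu : 'rV[R]_d, spatial_quantile P alpha u mu,
      ~ concentrated_on_line P ->
        exists! mu : 'rV[R]_d, spatial_quantile P alpha u mu,
      ~ concentrated_on_line_dir P u -> 0 < alpha ->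
        exists! mu : 'rV[R]_d, spatial_quantile P alpha u mu
    & forall z0 : 'rV[R]_d, P (line z0 u) = 1%E ->
        forall mu : 'rV[R]_d, spatial_quantile P alpha u mu ->
          line z0 u mu /\
          exists2 l : R,
            spatial_quantile1 (line_distribution P z0 u) alpha 1 l
            & mu = z0 + l *: u].
Proof.
have [mu qmu] := spatial_quantile_exists P halpha hu.
split; first by exists mu.
- move=> noline; exists mu; split=> // nu qnu; apply/eqP/negPn/negP => neq.
  have nv : enorm (nu - mu) != 0 by rewrite enorm_eq0 subr_eq0 eq_sym.
  apply: noline; exists ((enorm (nu - mu))^-1 *: (nu - mu)).
    by rewrite /sphere /= enormZ ger0_norm ?invr_ge0 ?enorm_ge0// mulVf.
  exists mu; apply/ae_line.
    by rewrite enormZ ger0_norm ?invr_ge0 ?enorm_ge0// mulVf.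
  refine (ae_imp (spatial_quantile_line neq qmu qnu) _) => z.
  by apply: line_scale; rewrite invr_eq0.
- move=> noline a0; exists mu; split=> // nu qnu; apply/eqP/negPn/negP => neq.
  apply: noline; exists mu; apply/(ae_line _ _ hu).
  have [c c0 ->] := spatial_quantile_dir hu a0 neq qmu qnu.
  refine (ae_imp (spatial_quantile_line neq qmu qnu) _) => z.
  exact: line_scale.
- move=> z0 PL nu qnu; have Lnu := spatial_quantile_in_line hu PL qnu.
  split=> //; have [l _ nuE] := Lnu; exists l => //.
  by apply: (spatial_quantile1_of_line hu PL); rewrite nuE.
Qed.
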